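(* Let $G$ be a finite simple graph that is connected and star-shaped, and let $T: G\to G$ be a graph endomorphism. Then $T$ has a fixed clique, i.e. there is a simplex $x$ of $G$ with $T(x)=x$.
   Context: A simplex (clique) of a finite simple graph $G=(V,E)$ is a complete subgraph $K_{k+1}$, $k\ge 0$, identified with its nonempty vertex set; it has dimension $k$. A connected graph is understood to be nonempty. A $k$-form is a real-valued function $f(x_0,\dots,x_k)$ on ordered $k$-simplices that is antisymmetric in its $k+1$ arguments. The exterior derivative is $df(x_0,\dots,x_{k+1})=\sum_i (-1)^i f(x_0,\dots,\hat{x_i},\dots,x_{k+1})$. The cohomology group $H^k(G)$ is the real vector space of closed $k$-forms ($df=0$) modulo exact $k$-forms ($f=dg$). A graph $G$ is called star-shaped if $H^k(G)$ is trivial for all $k\ge 1$. A graph endomorphism $T$ of $G$ is a map $T:V\to V$ such that $(a,b)\in E$ implies $(T(a),T(b))\in E$. A simplex $x$ is fixed by $T$ if $T(x)=x$ as a set of vertices. *)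

(* Defs.v *)
From HB Require Import structures.
From mathcomp Require Import all_boot all_order all_algebra all_fingroup.
From mathcomp Require Import generic_quotient boolp reals.

Set Implicit Arguments.
Unset Strict Implicit.
Unset Printing Implicit Defensive.
Import GRing.Theory.

Local Open Scope ring_scope.
Local Open Scope quotient_scope.

Record sgraph := SGraph {
  vertex :> finType;
  edge : rel vertex;
  edge_sym : symmetric edge;
  edge_irr : irreflexive edge }.

Definition connected_graph (G : sgraph) : Prop :=
  (0 < #|G|)%N /\ forall x y : G, connect (@edge G) x y.

Definition is_endomorphism (G : sgraph) (T : G -> G) : Prop :=
  forall a b : G, edge a b -> edge (T a) (T b).

Definition is_simplex (G : sgraph) (x : {set G}) : bool :=
  (x != set0) && [forall a in x, forall b in x, (a != b) ==> edge a b].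

Section Simplices.
Variable G : sgraph.

(* The vertices of an ordered simplex are automatically distinct, because
   [edge] is irreflexive. *)
Definition ordered_clique k (x : {ffun 'I_k.+1 -> G}) : bool :=
  [forall i, forall j, (i != j) ==> edge (x i) (x j)].

Record osimplex k := OSimplex {
  osimplex_val :> {ffun 'I_k.+1 -> G};
  osimplexP : ordered_clique osimplex_val }.

HB.instance Definition _ k := [isSub for @osimplex_val k].
HB.instance Definition _ k := [Finite of osimplex k by <:].

Lemma face_subproof k (x : osimplex k.+1) (i : 'I_k.+2) :
  ordered_clique [ffun j => x (lift i j)].
Proof.
apply/forallP=> a; apply/forallP=> b; apply/implyP=> ab; rewrite !ffunE.
have /forallP/(_ (lift i a))/forallP/(_ (lift i b))/implyP := osimplexP x.
by apply; rewrite (inj_eq lift_inj).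
Qed.
Definition face k (x : osimplex k.+1) (i : 'I_k.+2) : osimplex k :=
  OSimplex (face_subproof x i).

Lemma permute_subproof k (x : osimplex k) (s : 'S_k.+1) :
  ordered_clique [ffun j => x (s j)].
Proof.
apply/forallP=> a; apply/forallP=> b; apply/implyP=> ab; rewrite !ffunE.
have /forallP/(_ (s a))/forallP/(_ (s b))/implyP := osimplexP x.
by apply; rewrite (inj_eq perm_inj).
Qed.
Definition permute k (x : osimplex k) (s : 'S_k.+1) : osimplex k :=
  OSimplex (permute_subproof x s).

End Simplices.

Section Forms.
Variables (R : realType) (G : sgraph).

(* The exponent [s] is the parity of the permutation [s], via [odd_perm]. *)
Definition antisymmetric_form k : {pred {ffun osimplex G k -> R^o}} :=
  fun f => [forall x, forall s : 'S_k.+1, f (permute x s) == (-1) ^+ s * f x].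

Lemma antisymmetric_submod k : submod_closed (@antisymmetric_form k).
Proof.
split=> [|a u v /forallP hu /forallP hv].
  by apply/forallP=> x; apply/forallP=> s; rewrite !ffunE mulr0.
apply/forallP=> x; apply/forallP=> s.
have /forallP/(_ s)/eqP eu := hu x; have /forallP/(_ s)/eqP ev := hv x.
by rewrite !ffunE eu ev mulrDr /GRing.scale /= mulrCA.
Qed.
HB.instance Definition _ k :=
  GRing.isSubmodClosed.Build R {ffun osimplex G k -> R^o}
    (@antisymmetric_form k) (@antisymmetric_submod k).

Record kform k := KForm {
  kform_val :> {ffun osimplex G k -> R^o};
  kformP : kform_val \in @antisymmetric_form k }.

HB.instance Definition _ k := [isSub for @kform_val k].
HB.instance Definition _ k := [Choice of kform k by <:].
HB.instance Definition _ k := [SubChoice_isSubLmodule of kform k by <:].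

Definition coboundary k (f : {ffun osimplex G k -> R^o}) :
    {ffun osimplex G k.+1 -> R^o} :=
  [ffun x => \sum_(i < k.+2) (-1) ^+ i * f (face x i)].

Lemma face_permute k (x : osimplex G k.+1) (s : 'S_k.+2) (i : 'I_k.+2) :
  exists2 t : 'S_k.+1, s = lift_perm i (s i) t &
    face (permute x s) i = permute (face x (s i)) t.
Proof.
have ht j : {l | s (lift i j) = lift (s i) l}.
  case: (unliftP (s i) (s (lift i j))) => [l|] e; first by exists l.
  by move/perm_inj/eqP: e; rewrite eq_sym (negPf (neq_lift _ _)).
have t_inj : injective (fun j => sval (ht j)).
  move=> a b /(congr1 (lift (s i))); rewrite -(svalP (ht a)) -(svalP (ht b)).
  by move/perm_inj/lift_inj.
exists (perm t_inj).
  apply/permP=> j; case: (unliftP i j) => [l|] ->.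
    by rewrite lift_perm_lift permE; apply: (svalP (ht l)).
  by rewrite lift_perm_id.
apply/val_inj/ffunP=> j; rewrite !ffunE permE.
by congr (x _); apply: (svalP (ht j)).
Qed.

Lemma coboundary_antisymmetric k (f : kform k) :
  coboundary f \in @antisymmetric_form k.+1.
Proof.
apply/forallP=> x; apply/forallP=> s; rewrite !ffunE; apply/eqP.
rewrite [in RHS](reindex_inj (@perm_inj _ s)) mulr_sumr /=; apply: eq_bigr => i _.
have [t st ->] := face_permute x s i.
have /forallP/(_ (face x (s i)))/forallP/(_ t)/eqP -> := kformP f.
have -> : (-1) ^+ s = (-1) ^+ i * (-1) ^+ s i * (-1) ^+ t :> R.
  by rewrite [in LHS]st odd_lift_perm !signr_addb !signr_odd.
rewrite !mulrA; congr (_ * _).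
have sqs : (-1) ^+ s i * (-1) ^+ s i = 1 :> R by rewrite -expr2 sqrr_sign.
by rewrite [RHS]mulrAC -[(-1) ^+ i * _ * _ in RHS]mulrA sqs mulr1.
Qed.
Definition extd k (f : kform k) : kform k.+1 :=
  KForm (coboundary_antisymmetric f).

Lemma extd_linear k : linear (@extd k).
Proof.
move=> a f g; apply/val_inj/ffunP=> x; rewrite !ffunE /= scaler_sumr -big_split.
by apply: eq_bigr => i _ /=; rewrite !ffunE mulrDr /GRing.scale /= mulrCA.
Qed.
HB.instance Definition _ k :=
  GRing.isLinear.Build R (kform k) (kform k.+1) _ (@extd k) (@extd_linear k).

Definition closed_form k : {pred kform k} := fun f => extd f == 0.

Lemma closed_form_submod k : submod_closed (@closed_form k).
Proof.
rewrite /closed_form; split=> [|a u v]; rewrite !unfold_in ?linear0 //.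
by move=> /eqP hu /eqP hv; rewrite extd_linear hu hv scaler0 addr0.
Qed.
HB.instance Definition _ k :=
  GRing.isSubmodClosed.Build R (kform k) (@closed_form k)
    (@closed_form_submod k).

Record cocycle k := Cocycle {
  cocycle_val :> kform k;
  cocycleP : cocycle_val \in @closed_form k }.

HB.instance Definition _ k := [isSub for @cocycle_val k].
HB.instance Definition _ k := [Choice of cocycle k by <:].
HB.instance Definition _ k := [SubChoice_isSubLmodule of cocycle k by <:].

(* There are no forms of degree -1, so 0 is the only exact 0-form. *)
Definition is_exact k : kform k -> Prop :=
  if k is k'.+1 then fun f => exists g : kform k', f = extd g
  else fun f => f = 0.

Definition exact_cocycle k : {pred cocycle k} :=
  fun f => `[< is_exact (cocycle_val f) >].

Lemma exact_cocycle_submod k : submod_closed (@exact_cocycle k).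
Proof.
split=> [|a u v /asboolP hu /asboolP hv]; apply/asboolP.
  by case: k => [|k] //=; exists 0; rewrite linear0.
case: k => [|k] /= in u v hu hv *; first by rewrite hu hv scaler0 addr0.
have [[g hg] [h hh]] := (hu, hv).
by exists (a *: g + h); rewrite extd_linear -hg -hh.
Qed.
HB.instance Definition _ k :=
  GRing.isSubmodClosed.Build R (cocycle k) (@exact_cocycle k)
    (@exact_cocycle_submod k).

Definition cohomology k := Quotient.quot (@exact_cocycle k).
HB.instance Definition _ k := GRing.Zmodule.on (cohomology k).
HB.instance Definition _ k := EqQuotient.on (cohomology k).

Definition cohomology_scale k (a : R) (c : cohomology k) : cohomology k :=
  \pi_(cohomology k) (a *: repr c).

Lemma pi_scale k a (f : cocycle k) :
  cohomology_scale a (\pi_(cohomology k) f) = \pi_(cohomology k) (a *: f).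
Proof.
apply/eqP; rewrite /cohomology_scale -Quotient.idealrBE -scalerBr.
by apply: rpredZ; rewrite Quotient.idealrBE reprK.
Qed.

Fact cohomology_scalerA k a b (c : cohomology k) :
  cohomology_scale a (cohomology_scale b c) = cohomology_scale (a * b) c.
Proof. by rewrite [cohomology_scale b c]/cohomology_scale pi_scale scalerA. Qed.

Fact cohomology_scale1r k : left_id 1 (@cohomology_scale k).
Proof. by move=> c; rewrite /cohomology_scale scale1r reprK. Qed.

Fact cohomology_scalerDr k : right_distributive (@cohomology_scale k) +%R.
Proof.
move=> a c c'; rewrite -[c]reprK -[c']reprK -[_ + _]Quotient.pi_add.
by rewrite !pi_scale scalerDr; apply: Quotient.pi_add.
Qed.

Fact cohomology_scalerDl k (c : cohomology k) :
  {morph (@cohomology_scale k)^~ c : a b / a + b}.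
Proof.
by move=> a b; rewrite /cohomology_scale scalerDl; apply: Quotient.pi_add.
Qed.

HB.instance Definition _ k := GRing.Zmodule_isLmodule.Build R (cohomology k)
  (@cohomology_scalerA k) (@cohomology_scale1r k) (@cohomology_scalerDr k)
  (@cohomology_scalerDl k).

End Forms.

Definition star_shaped (R : realType) (G : sgraph) : Prop :=
  forall k : nat, (1 <= k)%N -> forall c : cohomology R G k, c = 0.

(* Main.v *)
Require Import Defs.
From mathcomp Require Import all_boot reals.
From HB Require Import structures.
From mathcomp Require Import all_order all_algebra all_fingroup.
From mathcomp Require Import generic_quotient boolp zify.

(** The proof is the Lefschetz fixed point argument.  An endomorphism [T] maps
    distinct adjacent vertices to distinct adjacent vertices, so it acts on
    ordered simplices, and the pullback [T^*] acts on forms and commutes with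
    the exterior derivative [d].  Connectedness says that the closed 0-forms
    are the constants, and star-shapedness that every closed k-form with
    [k >= 1] is exact.  Write [z_k] for the trace of [T^*] on closed k-forms.
    Since [d] induces an equivariant isomorphism from k-forms modulo closed
    k-forms onto closed (k+1)-forms, the trace of [T^*] on k-forms is
    [z_k + z_{k+1}] ([trace_cocycles_step]).  If [T] fixes no simplex then all
    traces on forms vanish ([trace_pullback_alt]); as there are no forms in high
    degree, descending induction gives [z_k = 0] for every [k].  But [z_0 = 1],
    because [T^*] fixes the constants.

    Traces on subspaces are computed without choosing bases of them: the trace
    of an endomorphism on an invariant subspace is its trace, on the ambient
    space, after composition with any projector onto the subspace
    ([trace_projector_unique]).  The ambient space is that of all real
    functions on ordered simplices, in which the antisymmetrization [alt] is a
    projector onto the forms.  Matrices act on row vectors, so that the matrix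
    of [g \o f] is the product of that of [f] by that of [g], in this order. *)

Set Implicit Arguments.
Unset Strict Implicit.
Unset Printing Implicit Defensive.
Import GRing.Theory Num.Theory.
Local Open Scope ring_scope.
Local Open Scope quotient_scope.

(** * Traces on invariant subspaces *)

Section Projectors.
Variable F : fieldType.

(** [P] is a projector onto the subspace of the row vectors [v] such that
    [v *m A = v] and [v *m D = 0]. *)
Definition projector_on n p (A : 'M[F]_n) (D : 'M[F]_(n, p)) (P : 'M[F]_n) :=
  [/\ P *m A = P, P *m D = 0
    & forall M : 'M_n, M *m A = M -> M *m D = 0 -> M *m P = M].

(** For an endomorphism [T] that preserves a subspace, composing [T] with any
    projector onto the subspace gives the same trace, namely that of the
    restriction of [T]. *)
Lemma trace_projector_unique n p (A T P Q : 'M[F]_n) (D : 'M[F]_(n, p)) T' :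
    T *m A = A *m T -> T *m D = D *m T' ->
    projector_on A D P -> projector_on A D Q ->
  \tr (T *m P) = \tr (T *m Q).
Proof.
move=> TA TD [PA PD Pid] [QA QD Qid].
have QTP : Q *m T *m P = Q *m T.
  apply: Pid; first by rewrite -mulmxA TA mulmxA QA.
  by rewrite -mulmxA TD mulmxA QD mul0mx.
have PQ : P *m Q = P by apply: Qid.
by rewrite mxtrace_mulC -PQ -mulmxA mxtrace_mulC QTP mxtrace_mulC.
Qed.

(** When [A] is idempotent, a pseudo-inverse of [A *m D] yields an explicit
    projector onto the kernel of [D] in the image of [A]. *)
Lemma kernel_projector n p (A : 'M[F]_n) (D : 'M[F]_(n, p)) :
    A *m A = A ->
  projector_on A D (A - A *m D *m pinvmx (A *m D) *m A).
Proof.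
move=> AA; set E := A *m D.
have AE : A *m E = E by rewrite mulmxA AA.
split=> [||M MA MD]; first by rewrite mulmxBl -[_ *m A *m A]mulmxA !AA.
- rewrite mulmxBl -[E *m _ *m A *m D]mulmxA -/E.
  by rewrite mulmxKpV ?submx_refl // subrr.
- by rewrite mulmxBr MA !mulmxA MA MD !mul0mx subr0.
Qed.

(** A subspace given as the row space of [B] has the projector
    [pinvmx B *m B]. *)
Lemma image_projector n p q (A : 'M[F]_n) (D : 'M[F]_(n, p))
    (B : 'M[F]_(q, n)) :
    B *m A = B -> B *m D = 0 ->
    (forall v : 'rV_n, v *m A = v -> v *m D = 0 -> (v <= B)%MS) ->
  projector_on A D (pinvmx B *m B).
Proof.
move=> BA BD subB; split=> [||M MA MD].
- by rewrite -[LHS]mulmxA BA.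
- by rewrite -[LHS]mulmxA BD mulmx0.
- rewrite mulmxA mulmxKpV //; apply/row_subP=> i.
  by apply: subB; rewrite -row_mul ?MA ?MD ?row0.
Qed.

(** Rank-nullity for traces: the trace of [T] on the image of [A] is the sum of
    its trace on the kernel of [D] there and of that of [T'] on the image of
    [A *m D]. *)
Lemma trace_kernel_image n p (A T : 'M[F]_n) (D : 'M[F]_(n, p)) (T' : 'M[F]_p) :
    A *m A = A -> T *m A = A *m T -> T *m D = D *m T' ->
  \tr (T *m A) = \tr (T *m (A - A *m D *m pinvmx (A *m D) *m A))
               + \tr (T' *m (pinvmx (A *m D) *m (A *m D))).
Proof.
move=> AA TA TD; set E := A *m D.
have TE : T *m E = E *m T' by rewrite mulmxA TA -mulmxA TD mulmxA.
have AE : A *m E = E by rewrite mulmxA AA.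
move: E (pinvmx E) AE TE => E P AE TE.
rewrite mulmxBr linearB /= -[LHS]addr0 -addrA; congr (_ + _).
apply/esym/eqP; rewrite addrC subr_eq0; apply/eqP.
rewrite [T *m _]mulmxA [RHS]mxtrace_mulC !mulmxA -TA -[T *m A *m E]mulmxA AE.
by rewrite TE -[in RHS]mulmxA [RHS]mxtrace_mulC.
Qed.

End Projectors.

(** * Matrices of linear maps between function spaces *)

Section FunctionMatrices.
Variable R : fieldType.

(** The row vector of values of [f], in the enumeration order of [I]. *)
Definition row_of (I : finType) (f : {ffun I -> R^o}) : 'rV[R]_#|I| :=
  \row_i f (enum_val i).

(** The indicator function of the point [x]. *)
Definition delta_fun (I : finType) (x : I) : {ffun I -> R^o} :=
  [ffun y => (y == x)%:R].

(** The matrix, in the bases of indicator functions, of a linear map between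
    spaces of functions on finite sets. *)
Definition mx_of (I J : finType) (f : {ffun I -> R^o} -> {ffun J -> R^o}) :
    'M[R]_(#|I|, #|J|) :=
  \matrix_(i, j) f (delta_fun (enum_val i)) (enum_val j).

Lemma row_of_inj (I : finType) : injective (@row_of I).
Proof.
move=> f g /rowP fg; apply/ffunP=> x; have := fg (enum_rank x).
by rewrite !mxE enum_rankK.
Qed.

Lemma row_of_surj (I : finType) (v : 'rV[R]_#|I|) : exists f, v = row_of f.
Proof.
exists [ffun x => v 0 (enum_rank x)].
by apply/rowP=> i; rewrite !mxE ffunE enum_valK.
Qed.

Lemma row_of0 (I : finType) : row_of (0 : {ffun I -> R^o}) = 0.
Proof. by apply/rowP=> i; rewrite !mxE ffunE. Qed.

Lemma ffun_sum_delta (I : finType) (f : {ffun I -> R^o}) :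
  f = \sum_x f x *: delta_fun x.
Proof.
apply/ffunP=> y; rewrite sum_ffunE (bigD1 y) //= !ffunE eqxx big1 ?addr0.
  by rewrite [_ *: _]mulr1.
by move=> x /negPf xy; rewrite !ffunE eq_sym xy [_ *: _]mulr0.
Qed.

Lemma mul_row_mx_of (I J : finType)
    (f : {linear {ffun I -> R^o} -> {ffun J -> R^o}}) v :
  row_of v *m mx_of f = row_of (f v).
Proof.
apply/rowP=> j; rewrite !mxE [in RHS](ffun_sum_delta v) linear_sum sum_ffunE.
rewrite (@big_enum_val _ _ _ _ I) /=; apply: eq_bigr => i _.
by rewrite !mxE linearZ ffunE.
Qed.

Lemma mx_ext (I : finType) n (A B : 'M[R]_(#|I|, n)) :
  (forall f : {ffun I -> R^o}, row_of f *m A = row_of f *m B) -> A = B.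
Proof.
move=> AB; apply/row_matrixP=> i; rewrite !rowE.
by have [f ->] := row_of_surj (delta_mx 0 i).
Qed.

Lemma mx_of_comp (I J K : finType)
    (f : {linear {ffun I -> R^o} -> {ffun J -> R^o}})
    (g : {linear {ffun J -> R^o} -> {ffun K -> R^o}}) :
  mx_of f *m mx_of g = mx_of (g \o f).
Proof. by apply: mx_ext => v; rewrite mulmxA !mul_row_mx_of. Qed.

Lemma trace_mx_of (I : finType) (f : {ffun I -> R^o} -> {ffun I -> R^o}) :
  \tr (mx_of f) = \sum_x f (delta_fun x) x.
Proof.
by rewrite (@big_enum_val _ _ _ _ I); apply: eq_bigr => i _; rewrite mxE.
Qed.

End FunctionMatrices.

(** * Forms and their pullback *)

Section Pullback.
Variables (R : realType) (G : sgraph).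
Local Notation cochain k := {ffun osimplex G k -> R^o}.

Lemma antisymmetricP k (f : cochain k) :
  reflect (forall x s, f (permute x s) = (-1) ^+ s * f x)
          (f \in @antisymmetric_form R G k).
Proof.
apply: (iffP forallP) => [h x s|h x]; first by have /forallP/(_ s)/eqP := h x.
by apply/forallP=> s; apply/eqP.
Qed.

Lemma permuteM k (x : osimplex G k) (s t : 'S_k.+1) :
  permute (permute x t) s = permute x (s * t).
Proof. by apply/val_inj/ffunP=> j; rewrite !ffunE permM. Qed.

(** The antisymmetrization of a function on ordered simplices. *)
Definition alt k (f : cochain k) : cochain k :=
  [ffun x => (k.+1)`!%:R^-1 * \sum_(s : 'S_k.+1) (-1) ^+ s * f (permute x s)].

Lemma alt_antisymmetric k (f : cochain k) :
  alt f \in @antisymmetric_form R G k.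
Proof.
apply/antisymmetricP=> x t; rewrite !ffunE mulrCA; congr (_ * _).
rewrite [in RHS](reindex_inj (@mulIg _ t)) mulr_sumr; apply: eq_bigr => s _.
by rewrite permuteM mulrA -signr_addb odd_permM addbC -addbA addbb addbF.
Qed.

Lemma alt_id k (f : cochain k) : f \in @antisymmetric_form R G k -> alt f = f.
Proof.
move=> /antisymmetricP fA; apply/ffunP=> x; rewrite ffunE.
rewrite (eq_bigr (fun=> f x)) => [|s _].
  rewrite sumr_const card_Sn -[f x *+ _]mulr_natl mulKf //.
  by rewrite pnatr_eq0 -lt0n fact_gt0.
by rewrite fA mulrA -signr_addb addbb mul1r.
Qed.

Lemma alt_linear k : linear (@alt k).
Proof.
move=> a f g; apply/ffunP=> x; rewrite !ffunE /GRing.scale /= mulrCA -mulrDr.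
congr (_ * _); rewrite mulr_sumr -big_split; apply: eq_bigr => s _ /=.
by rewrite !ffunE mulrDr /GRing.scale /= mulrCA.
Qed.
HB.instance Definition _ k :=
  GRing.isLinear.Build R (cochain k) (cochain k) _ (@alt k) (@alt_linear k).

Lemma coboundary_linear k : linear (@coboundary R G k).
Proof.
move=> a f g; apply/ffunP=> x; rewrite !ffunE /= scaler_sumr -big_split.
by apply: eq_bigr => i _ /=; rewrite !ffunE mulrDr /GRing.scale /= mulrCA.
Qed.
HB.instance Definition _ k :=
  GRing.isLinear.Build R (cochain k) (cochain k.+1) _ (@coboundary R G k)
    (@coboundary_linear k).

Lemma coboundary_alt_antisymmetric k (f : cochain k) :
  coboundary (alt f) \in @antisymmetric_form R G k.+1.
Proof. exact: (coboundary_antisymmetric (KForm (alt_antisymmetric f))). Qed.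

Lemma face_face k (x : osimplex G k.+2) i j i' j' :
    i' = lift i j -> i = lift i' j' ->
  face (face x i) j = face (face x i') j'.
Proof.
move=> ei' ei; apply/val_inj/ffunP=> l; rewrite !ffunE; congr (x _).
apply: val_inj => /=; move: ei ei' => /(congr1 val) /= ei /(congr1 val) /= ei'.
rewrite bumpC -ei'; congr bump; congr bump.
by move: ei ei'; rewrite /bump /unbump; lia.
Qed.

(** Deleting two vertices in either order gives the same face with opposite
    signs, and exchanging the order is an involution without fixed points on
    the terms of the double sum. *)
Lemma coboundary_coboundary k (f : cochain k) : coboundary (coboundary f) = 0.
Proof.
apply/ffunP=> x; rewrite !ffunE.
under eq_bigr do rewrite ffunE mulr_sumr.
rewrite pair_bigA /=; set S := \sum_p _.
pose swap (p : 'I_k.+3 * 'I_k.+2) :=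
  (lift p.1 p.2, odflt p.2 (unlift (lift p.1 p.2) p.1)).
have swapE p : p.1 = lift (swap p).1 (swap p).2.
  rewrite /swap /=; case: unliftP => //= /eqP.
  by rewrite (negPf (neq_lift _ _)).
have swapK : involutive swap.
  move=> [i j]; rewrite {1}/swap -swapE; congr (_, _) => /=.
  by rewrite liftK.
suff SN : S = - S.
  by apply/eqP; rewrite -[_ == 0](mulrn_eq0 S 2) mulr2n {1}SN addNr.
rewrite {1}/S (reindex_inj (inv_inj swapK)) -sumrN; apply: eq_bigr => p _.
rewrite (@face_face _ x p.1 p.2 (swap p).1 (swap p).2) // !mulrA -mulNr -!exprD.
congr (_ * _); rewrite -[RHS]mulN1r -exprS -signr_odd -[RHS]signr_odd.
congr (_ ^+ nat_of_bool _).
(* Exactly one of the two indices is shifted by one when the order changes. *)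
have := congr1 val (swapE p); rewrite /= /bump; lia.
Qed.

Variables (T : G -> G) (Tendo : is_endomorphism T).

Fact map_osimplex_subproof k (x : osimplex G k) :
  ordered_clique [ffun j => T (x j)].
Proof.
apply/forallP=> a; apply/forallP=> b; apply/implyP=> ab; rewrite !ffunE.
apply: Tendo.
by have /forallP/(_ a)/forallP/(_ b)/implyP := osimplexP x; apply.
Qed.

(** The action of the endomorphism on ordered simplices: adjacent vertices have
    adjacent, hence distinct, images, so the dimension is preserved. *)
Definition map_osimplex k (x : osimplex G k) : osimplex G k :=
  OSimplex (map_osimplex_subproof x).

Lemma map_osimplex_permute k (x : osimplex G k) s :
  map_osimplex (permute x s) = permute (map_osimplex x) s.
Proof. by apply/val_inj/ffunP=> j; rewrite !ffunE. Qed.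

Lemma map_osimplex_face k (x : osimplex G k.+1) i :
  map_osimplex (face x i) = face (map_osimplex x) i.
Proof. by apply/val_inj/ffunP=> j; rewrite !ffunE. Qed.

(** The pullback [T^*], on all functions on ordered simplices. *)
Definition pullback k (f : cochain k) : cochain k :=
  [ffun x => f (map_osimplex x)].

Lemma pullback_linear k : linear (@pullback k).
Proof. by move=> a f g; apply/ffunP=> x; rewrite !ffunE. Qed.
HB.instance Definition _ k :=
  GRing.isLinear.Build R (cochain k) (cochain k) _ (@pullback k)
    (@pullback_linear k).

Lemma alt_pullback k (f : cochain k) : alt (pullback f) = pullback (alt f).
Proof.
apply/ffunP=> x; rewrite !ffunE; congr (_ * _); apply: eq_bigr => s _.
by rewrite ffunE map_osimplex_permute.
Qed.

Lemma coboundary_pullback k (f : cochain k) :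
  coboundary (pullback f) = pullback (coboundary f).
Proof.
apply/ffunP=> x; rewrite !ffunE; apply: eq_bigr => i _.
by rewrite ffunE map_osimplex_face.
Qed.

(** An ordered simplex that is mapped to a reordering of itself spans a fixed
    simplex. *)
Lemma map_osimplex_fixed k (x : osimplex G k) s :
  map_osimplex (permute x s) = x ->
  exists y : {set G}, is_simplex y /\ T @: y = y.
Proof.
move=> fx; exists [set x i | i : 'I_k.+1]; split.
  apply/andP; split; first by apply/set0Pn; exists (x ord0); apply: imset_f.
  apply/forall_inP=> _ /imsetP[i _ ->]; apply/forall_inP=> _ /imsetP[j _ ->].
  apply/implyP=> xij; have /forallP/(_ i)/forallP/(_ j)/implyP := osimplexP x.
  by apply; apply: contraNneq xij => ->.
have Txs j : T (x (s j)) = x j by rewrite -[in RHS]fx !ffunE.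
apply/setP=> a; apply/imsetP/imsetP=> [[_ /imsetP[i _ ->] ->]|[i _ ->]].
  by exists ((s^-1)%g i); rewrite // -[RHS]Txs permKV.
by exists (x (s i)); rewrite ?Txs // imset_f.
Qed.

(** If no simplex is fixed then the diagonal coefficients of [alt \o pullback]
    vanish, and with them the trace of the pullback on forms. *)
Lemma trace_pullback_alt k :
    ~ (exists y : {set G}, is_simplex y /\ T @: y = y) ->
  \tr (mx_of (@pullback k) *m mx_of (@alt k)) = 0.
Proof.
move=> nofix; rewrite mx_of_comp trace_mx_of big1 // => x _ /=.
rewrite ffunE big1 ?mulr0 // => s _; rewrite !ffunE.
by case: eqP => [/map_osimplex_fixed//|_]; rewrite mulr0.
Qed.

End Pullback.

(** * Exactness of the complex of forms *)

Section Exactness.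
Variables (R : realType) (G : sgraph).
Local Notation cochain k := {ffun osimplex G k -> R^o}.

(** The vanishing of cohomology in terms of forms: closed forms of positive
    degree are exact. *)
Lemma star_shaped_exact k (f : cochain k.+1) :
    star_shaped R G -> f \in @antisymmetric_form R G k.+1 -> coboundary f = 0 ->
  exists2 g : cochain k, g \in @antisymmetric_form R G k & f = coboundary g.
Proof.
move=> Gstar fA df.
have fC : KForm fA \in @closed_form R G k.+1 by apply/eqP/val_inj.
set c : cocycle R G k.+1 := Cocycle fC.
(* The class of [f] and the class of 0 both vanish, so they coincide. *)
have /eqP : \pi_(cohomology R G k.+1) c = \pi_(cohomology R G k.+1) 0.
  by rewrite (Gstar _ _ (\pi c)) // (Gstar _ _ (\pi 0)).
rewrite -Quotient.idealrBE subr0 => /asboolP[g /(congr1 val) /= fg].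
by exists (val g); first exact: kformP.
Qed.

Fact point_subproof (a : G) : ordered_clique [ffun _ : 'I_1 => a].
Proof. by apply/forallP=> i; apply/forallP=> j; rewrite !ord1. Qed.

(** The vertex [a] as an ordered 0-simplex. *)
Definition point (a : G) : osimplex G 0 := OSimplex (point_subproof a).

Lemma pointK (x : osimplex G 0) : point (x ord0) = x.
Proof. by apply/val_inj/ffunP=> i; rewrite !ffunE (ord1 i). Qed.

Lemma edge_osimplex (a b : G) : edge a b ->
  exists x : osimplex G 1, face x ord0 = point b /\ face x ord_max = point a.
Proof.
move=> ab.
have xP : ordered_clique [ffun i : 'I_2 => if i == ord0 then a else b].
  apply/forallP=> -[[|[|//]] i]; apply/forallP=> -[[|[|//]] j] //=.
    by rewrite !ffunE /= ab.
  by rewrite !ffunE /= edge_sym ab.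
by exists (OSimplex xP); split; apply/val_inj/ffunP=> i; rewrite !ffunE ord1.
Qed.

Lemma closed_form0_const (f : cochain 0) x y :
  connected_graph G -> coboundary f = 0 -> f x = f y.
Proof.
move=> [_ Gconn] df.
have f_edge a b : edge a b -> f (point a) = f (point b).
  move=> /edge_osimplex[z [z0 z1]]; have /ffunP/(_ z) := df.
  rewrite !ffunE !big_ord_recl big_ord0 addr0 expr0 mul1r expr1 mulN1r z0.
  have -> : lift ord0 ord0 = ord_max :> 'I_2 by apply: val_inj.
  by rewrite z1 => /subr0_eq.
have /connectP[p] := Gconn (x ord0) (y ord0).
rewrite -[in f x](pointK x) -[in f y](pointK y).
elim: p (x ord0) => [|b p IHp] a /= => [_ <- //|/andP[ab bp] yE].
by rewrite (f_edge _ _ ab); apply: IHp.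
Qed.

Lemma antisymmetric_form0 (f : cochain 0) : f \in @antisymmetric_form R G 0.
Proof.
apply/antisymmetricP=> x s.
have -> : s = 1%g by apply/permP=> i; rewrite !ord1.
rewrite odd_perm1 mul1r; congr (f _).
by apply/val_inj/ffunP=> i; rewrite ffunE perm1.
Qed.

Lemma card_osimplex_eq0 k : (#|G| <= k)%N -> #|{: osimplex G k}| = 0%N.
Proof.
move=> Gk; apply: eq_card0 => x; have x_inj : injective (osimplex_val x).
  move=> i j xij; apply/eqP/negPn/negP=> ij.
  have /forallP/(_ i)/forallP/(_ j)/implyP/(_ ij) := osimplexP x.
  by rewrite xij edge_irr.
by have := leq_card _ x_inj; rewrite card_ord leqNgt ltnS Gk.
Qed.

End Exactness.

(** * The Lefschetz fixed point argument *)

Section Lefschetz.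
Variables (R : realType) (G : sgraph) (T : G -> G) (Tendo : is_endomorphism T).
Local Notation cochain k := {ffun osimplex G k -> R^o}.
Local Notation altM k := (mx_of (@alt R G k)).
Local Notation dM k := (mx_of (@coboundary R G k)).
Local Notation pullM k := (mx_of (@pullback R G T Tendo k)).

Lemma altM_idem k : altM k *m altM k = altM k.
Proof.
apply: mx_ext => f; rewrite mulmxA !mul_row_mx_of /=.
by rewrite alt_id ?alt_antisymmetric.
Qed.

Lemma pullM_altM k : pullM k *m altM k = altM k *m pullM k.
Proof.
by apply: mx_ext => f; rewrite !mulmxA !mul_row_mx_of /= alt_pullback.
Qed.

Lemma pullM_dM k : pullM k *m dM k = dM k *m pullM k.+1.
Proof.
by apply: mx_ext => f; rewrite !mulmxA !mul_row_mx_of /= coboundary_pullback.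
Qed.

(** Membership in the subspace of closed forms, for a row vector. *)
Lemma closed_rowP k (v : 'rV_#|{: osimplex G k}|) :
    v *m altM k = v -> v *m dM k = 0 ->
  exists f : cochain k,
    [/\ v = row_of f, f \in @antisymmetric_form R G k & coboundary f = 0].
Proof.
have [f ->] := row_of_surj v; rewrite !mul_row_mx_of /= -(row_of0 R).
move=> /row_of_inj fA /row_of_inj df; exists f; split=> //.
by rewrite -fA alt_antisymmetric.
Qed.

(** In positive degree the closed forms are the row space of [altM k *m dM k]. *)
Lemma exact_projector k : star_shaped R G ->
  projector_on (altM k.+1) (dM k.+1)
    (pinvmx (altM k *m dM k) *m (altM k *m dM k)).
Proof.
move=> Gstar; apply: image_projector => [||v vA vD].
- apply: mx_ext => f; rewrite !mulmxA !mul_row_mx_of /=.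
  by rewrite alt_id ?coboundary_alt_antisymmetric.
- apply: mx_ext => f; rewrite !mulmxA !mul_row_mx_of /= coboundary_coboundary.
  by rewrite row_of0 mulmx0.
- have [f [-> fA df]] := closed_rowP vA vD.
  have [g gA ->] := star_shaped_exact Gstar fA df.
  by rewrite -{1}(alt_id gA) -!mul_row_mx_of /= -mulmxA submxMl.
Qed.

(** The function constantly equal to the mean value of [f]: a projector onto the
    constants, that is, onto the closed 0-forms of a connected graph. *)
Definition mean (f : cochain 0) : cochain 0 :=
  [ffun _ => #|{: osimplex G 0}|%:R^-1 * \sum_x f x].

Lemma mean_linear : linear mean.
Proof.
move=> a f g; apply/ffunP=> x; rewrite !ffunE /GRing.scale /= mulrCA -mulrDr.
congr (_ * _); rewrite mulr_sumr -big_split; apply: eq_bigr => y _ /=.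
by rewrite !ffunE.
Qed.
HB.instance Definition _ :=
  GRing.isLinear.Build R (cochain 0) (cochain 0) _ mean mean_linear.

Lemma card_osimplex0 : connected_graph G -> #|{: osimplex G 0}|%:R != 0 :> R.
Proof.
move=> [/card_gt0P[a _] _]; rewrite pnatr_eq0 -lt0n.
by apply/card_gt0P; exists (point a).
Qed.

Lemma mean_projector : connected_graph G ->
  projector_on (altM 0) (dM 0) (mx_of mean).
Proof.
move=> Gconn; split=> [||M MA MD].
- apply: mx_ext => f; rewrite !mulmxA !mul_row_mx_of /=.
  by rewrite alt_id ?antisymmetric_form0.
- apply: mx_ext => f; rewrite !mulmxA !mul_row_mx_of /= mulmx0 -(row_of0 R).
  congr row_of; apply/ffunP=> x; rewrite !ffunE !big_ord_recl big_ord0 !ffunE.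
  by rewrite expr0 expr1 mul1r mulN1r addr0 subrr.
- apply/row_matrixP=> i; rewrite row_mul.
  have [||f [-> _ df]] := @closed_rowP _ (row i M).
  + by rewrite -row_mul MA.
  + by rewrite -row_mul MD row0.
  rewrite mul_row_mx_of; congr row_of; apply/ffunP=> x; rewrite ffunE.
  rewrite (eq_bigr (fun=> f x)) => [|y _]; last exact: closed_form0_const.
  by rewrite sumr_const -[f x *+ _]mulr_natl mulKf // card_osimplex0.
Qed.

Lemma trace_pullback_mean : connected_graph G ->
  \tr (pullM 0 *m mx_of mean) = 1.
Proof.
move=> Gconn; rewrite mx_of_comp trace_mx_of /=.
under eq_bigr do rewrite ffunE; rewrite -mulr_sumr exchange_big /=.
rewrite (eq_bigr (fun=> 1)) => [|y _].
  by rewrite sumr_const mulVf // card_osimplex0.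
rewrite (bigD1 (map_osimplex Tendo y)) //= big1 => [|x /negPf xy].
  by rewrite !ffunE eqxx addr0.
by rewrite !ffunE eq_sym xy.
Qed.

(** The trace of the pullback on closed k-forms, computed with the projector of
    [kernel_projector]; by [cocycle_traceE] any other projector will do. *)
Definition cocycle_trace k : R :=
  \tr (pullM k *m
       (altM k - altM k *m dM k *m pinvmx (altM k *m dM k) *m altM k)).

Lemma cocycle_traceE k P : projector_on (altM k) (dM k) P ->
  cocycle_trace k = \tr (pullM k *m P).
Proof.
apply: trace_projector_unique (pullM_altM k) (pullM_dM k) _.
exact/kernel_projector/altM_idem.
Qed.

(** The closed (k+1)-forms are the images of the k-forms, so [trace_kernel_image]
    splits the trace on k-forms. *)
Lemma trace_cocycles_step k : star_shaped R G ->
  \tr (pullM k *m altM k) = cocycle_trace k + cocycle_trace k.+1.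
Proof.
move=> Gstar; rewrite (cocycle_traceE (exact_projector k Gstar)).
exact: trace_kernel_image (altM_idem k) (pullM_altM k) (pullM_dM k).
Qed.

(** Descending induction from degree [#|G|], where there are no simplices. *)
Lemma cocycle_trace_eq0 k :
    star_shaped R G -> ~ (exists y : {set G}, is_simplex y /\ T @: y = y) ->
  cocycle_trace k = 0.
Proof.
move=> Gstar nofix.
have: (#|G| <= k + #|G|)%N by rewrite leq_addl.
elim: {2}#|G| k => [|m IHm] k leGk.
  rewrite /cocycle_trace /mxtrace big1 // => i _.
  by have := ltn_ord i; rewrite [X in (_ < X)%N]card_osimplex_eq0 // -[k]addn0.
have := trace_cocycles_step k Gstar.
by rewrite (trace_pullback_alt _ _ _ nofix) (IHm k.+1) ?addSnnS // addr0.
Qed.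

End Lefschetz.

Theorem theorem3p2 (R : realType) (G : sgraph) (T : G -> G)
    (Gconn : connected_graph G) (Gstar : star_shaped R G)
    (Tendo : is_endomorphism T) :
  exists x : {set G}, is_simplex x /\ T @: x = x.
Proof.
apply: contrapT => nofix; have /eqP := cocycle_trace_eq0 Tendo 0 Gstar nofix.
rewrite (cocycle_traceE Tendo (mean_projector R Gconn)).
by rewrite trace_pullback_mean // oner_eq0.
Qed.
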